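(* Let $\Gamma$ be a (finite) directed network, $I(\Gamma)$ its graph inverse semigroup and $T(\Gamma)$ the semigroup generated by the tensors in $T^0\cup T\cup T^*$ and $\emptyset$ under $\overline{\oplus}$. The map $\theta:I(\Gamma)\to T(\Gamma)$ defined on generators (and extended multiplicatively) by the rule that (i) $\theta(v)=v^v_v$ for any $v\in\Gamma^0$; (ii) $\theta(e)=e^{r(e)}_{s(e)}$ for any $e\in\Gamma^1$; (iii) $\theta(e^* )=e^{s(e)}_{r(e)}$ for any $e^*\in(\Gamma^1)^*$; (iv) $\theta(o)=\emptyset$, is an isomorphism.
   Context: $\Gamma$ is a finite directed graph with vertex set $\Gamma^0$, edge set $\Gamma^1$, and source and range maps $s,r:\Gamma^1\to\Gamma^0$; put $s(v)=r(v)=v$ for $v\in\Gamma^0$. For each $e\in\Gamma^1$ there is a formal inverse $e^*$ with $s(e^* )=r(e)$, $r(e^* )=s(e)$; $(\Gamma^1)^*=\{e^*\mid e\in\Gamma^1\}$ is disjoint from $\Gamma^1$. The graph inverse semigroup $I(\Gamma)$ is the semigroup with zero element $o$ generated by $\Gamma^0\cup\Gamma^1\cup(\Gamma^1)^*$ subject to: (I1) $s(e)e=er(e)=e$ for all $e\in\Gamma^0\cup\Gamma^1\cup(\Gamma^1)^*$; (I2) $uv=o$ for $u,v\in\Gamma^0$, $u\ne v$; (I3) $e^*f=o$ for $e,f\in\Gamma^1$, $e\neq f$; (I4) $e^*e=r(e)$ for $e\in\Gamma^1$. For a tensor $t$ with covariant index $a$ and contra-variant index $b$ (written $t^b_a$)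 put $\psi(t)=a$, $\varphi(t)=b$. Define three pairwise disjoint sets of tensors: $T=\{e^{r(e)}_{s(e)}\mid e\in\Gamma^1\}$ (abbreviated $e$; $\psi(e)=s(e)$, $\varphi(e)=r(e)$); $T^0=\{v^v_v\mid v\in\Gamma^0\}$ (abbreviated $v$; $\psi(v)=\varphi(v)=v$); $T^*=\{e^{s(e)}_{r(e)}\mid e\in\Gamma^1\}$ (abbreviated $e^*$; $\psi(e^* )=r(e)$, $\varphi(e^* )=s(e)$), with $(e^* )^*=e$. For $t_1,t_2\in T^0\cup T\cup T^*$ define $t_1\overline{\oplus}t_2$ to be: - $t_1$, if $t_2\in T^0$ and $\varphi(t_1)=\psi(t_2)$; - $t_2$, if $t_1\in T^0$ and $\varphi(t_1)=\psi(t_2)$; - the word $t_1t_2$, if $\varphi(t_1)=\psi(t_2)$ and either $t_1,t_2\in T$, or $t_1,t_2\in T^*$, or $t_1\in T$ and $t_2\in T^*$; - the element $\varphi(t_2)$ of $T^0$, if $t_1\in T^*$, $t_2\in T$ and $t_1^*=t_2$; - $\emptyset$, otherwise. Also $\emptyset\overline{\oplus}t=t\overline{\oplus}\emptyset=\emptyset$. The operation extends to words as follows. For a word $w=t_1\cdots t_k$ and $t\in T^0\cup T\cup T^*$, $w\,\overline{\oplus}\,t=t_1\cdots t_{k-1}(t_k\overline{\oplus}t)$, which is understood as $\emptyset$ if $t_k\overline{\oplus}t=\emptyset$, and as $t_1\cdots t_{k-1}$ if $k\ge2$ and $t_k\overline{\oplus}t\in T^0$. For two words, $w\,\overline{\oplus}\,(u_1u_2\cdots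 u_m)=(\cdots((w\,\overline{\oplus}\,u_1)\overline{\oplus}u_2)\overline{\oplus}\cdots)\overline{\oplus}u_m$. The element $\emptyset$ is absorbing. $T(\Gamma)$ is the set consisting of $\emptyset$ and all words obtained from elements of $T^0\cup T\cup T^*$ by repeatedly applying $\overline{\oplus}$; it is a semigroup under $\overline{\oplus}$. *)

(* Defs.v *)
From HB Require Import structures.
From mathcomp Require Import all_boot.
From mathcomp Require Import boolp.

Set Implicit Arguments.
Unset Strict Implicit.
Unset Printing Implicit Defensive.

(* Loops and parallel edges are allowed. *)
Record digraph := Digraph {
  vertex : finType;
  edge : finType;
  src : edge -> vertex;
  rng : edge -> vertex }.

Inductive letter (G : digraph) :=
  | Vtx of vertex G
  | Edg of edge G
  | Inv of edge G.

Arguments Vtx {G} v.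
Arguments Edg {G} e.
Arguments Inv {G} e.

Section LetterFinite.
Variable G : digraph.

Definition letter_code (x : letter G) : vertex G + (edge G + edge G) :=
  match x with Vtx v => inl v | Edg e => inr (inl e) | Inv e => inr (inr e) end.

Definition letter_decode (c : vertex G + (edge G + edge G)) : letter G :=
  match c with
  | inl v => Vtx v | inr (inl e) => Edg e | inr (inr e) => Inv e
  end.

Lemma letter_codeK : cancel letter_code letter_decode.
Proof. by case. Qed.

HB.instance Definition _ := Finite.copy (letter G) (can_type letter_codeK).

End LetterFinite.

Definition lsrc (G : digraph) (x : letter G) : vertex G :=
  match x with Vtx v => v | Edg e => src e | Inv e => rng e end.

Definition lrng (G : digraph) (x : letter G) : vertex G :=
  match x with Vtx v => v | Edg e => rng e | Inv e => src e end.

(* A semigroup with zero given by generators and relations is the quotient of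
   the terms over the generators and [o] by the least congruence containing
   the axioms of semigroups with zero and the defining relations. *)
Section GraphInverseSemigroup.
Variable G : digraph.

Inductive term :=
  | TZero
  | TGen of letter G
  | TMul of term & term.

HB.instance Definition _ := gen_eqMixin term.
HB.instance Definition _ := gen_choiceMixin term.

Local Notation "x ** y" := (TMul x y) (at level 40, left associativity).

Inductive gis_cong : term -> term -> Prop :=
  | gis_refl x : gis_cong x x
  | gis_sym x y : gis_cong x y -> gis_cong y x
  | gis_trans x y z : gis_cong x y -> gis_cong y z -> gis_cong x z
  | gis_mul x x' y y' :
      gis_cong x x' -> gis_cong y y' -> gis_cong (x ** y) (x' ** y')
  | gis_assoc x y z : gis_cong (x ** (y ** z)) (x ** y ** z)
  | gis_zerol x : gis_cong (TZero ** x) TZero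
  | gis_zeror x : gis_cong (x ** TZero) TZero
  | gis_I1l a : gis_cong (TGen (Vtx (lsrc a)) ** TGen a) (TGen a)
  | gis_I1r a : gis_cong (TGen a ** TGen (Vtx (lrng a))) (TGen a)
  | gis_I2 u v : u <> v -> gis_cong (TGen (Vtx u) ** TGen (Vtx v)) TZero
  | gis_I3 e f : e <> f -> gis_cong (TGen (Inv e) ** TGen (Edg f)) TZero
  | gis_I4 e : gis_cong (TGen (Inv e) ** TGen (Edg e)) (TGen (Vtx (rng e))).

Definition gis_eqv : rel term := fun x y => `[< gis_cong x y >].

Lemma gis_eqv_refl : reflexive gis_eqv.
Proof. by move=> x; apply/asboolP; exact: gis_refl. Qed.

Lemma gis_eqv_sym : symmetric gis_eqv.
Proof. by move=> x y; apply/asboolP/asboolP; exact: gis_sym. Qed.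

Lemma gis_eqv_trans : transitive gis_eqv.
Proof.
by move=> y x z /asboolP xy /asboolP yz; apply/asboolP; exact: gis_trans xy yz.
Qed.

Canonical gis_equiv_rel :=
  EquivRel gis_eqv gis_eqv_refl gis_eqv_sym gis_eqv_trans.

Local Open Scope quotient_scope.

Definition gis := {eq_quot gis_equiv_rel}.
HB.instance Definition _ := Choice.on gis.

Definition gis_of (x : term) : gis := \pi_{eq_quot gis_equiv_rel} x.

Definition gis_zero : gis := gis_of TZero.
Definition gis_gen (a : letter G) : gis := gis_of (TGen a).

Definition gis_op (x y : gis) : gis :=
  gis_of (repr x ** repr y).

Lemma gis_ofP x y : gis_of x = gis_of y <-> gis_cong x y.
Proof. by split=> [/eqmodP/asboolP|/asboolP xy]; last exact/eqmodP. Qed.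

Lemma gis_repr x : gis_cong (repr (gis_of x)) x.
Proof. by apply/gis_ofP; rewrite /gis_of reprK. Qed.

Lemma gis_opE x y : gis_op (gis_of x) (gis_of y) = gis_of (x ** y).
Proof. by apply/gis_ofP; apply: gis_mul; exact: gis_repr. Qed.

Lemma gis_ofK (x : gis) : gis_of (repr x) = x.
Proof. by rewrite /gis_of reprK. Qed.

Lemma gis_opA : associative gis_op.
Proof.
move=> x y z; rewrite -(gis_ofK x) -(gis_ofK y) -(gis_ofK z) !gis_opE.
by apply/gis_ofP; exact: gis_assoc.
Qed.

HB.instance Definition _ := isSemigroup.Build gis gis_opA.

End GraphInverseSemigroup.

(* A tensor t^b_a: [tsym] is its symbol, [psi] its covariant index a and [phi]
   its contravariant index b. *)
Record tensor (G : digraph) := Tensor {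
  tsym : letter G;
  psi : vertex G;
  phi : vertex G }.

Section Tensors.
Variable G : digraph.

Definition tensor_code (t : tensor G) := (tsym t, psi t, phi t).

Definition tensor_decode (c : letter G * vertex G * vertex G) : tensor G :=
  Tensor c.1.1 c.1.2 c.2.

Lemma tensor_codeK : cancel tensor_code tensor_decode.
Proof. by case. Qed.

HB.instance Definition _ := Finite.copy (tensor G) (can_type tensor_codeK).

Definition vtensor (v : vertex G) : tensor G := Tensor (Vtx v) v v.
Definition etensor (e : edge G) : tensor G := Tensor (Edg e) (src e) (rng e).
Definition itensor (e : edge G) : tensor G := Tensor (Inv e) (rng e) (src e).

Definition tensT0 : {pred tensor G} := [in codom vtensor].
Definition tensT : {pred tensor G} := [in codom etensor].
Definition tensTs : {pred tensor G} := [in codom itensor].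

Definition tens_gen : {pred tensor G} :=
  [pred t | [|| t \in tensT0, t \in tensT | t \in tensTs]].

Definition tstar (t : tensor G) : tensor G :=
  Tensor (match tsym t with Vtx v => Vtx v | Edg e => Inv e | Inv e => Edg e end)
         (phi t) (psi t).

(* [None] stands for the empty-set symbol, [Some w] for the word w. Only
   nonempty words over T0, T and T* are meaningful. *)
Definition tword := option (seq (tensor G)).

Definition tplus (t1 t2 : tensor G) : tword :=
  if (t2 \in tensT0) && (phi t1 == psi t2) then Some [:: t1]
  else if (t1 \in tensT0) && (phi t1 == psi t2) then Some [:: t2]
  else if (phi t1 == psi t2) &&
          [|| (t1 \in tensT) && (t2 \in tensT),
              (t1 \in tensTs) && (t2 \in tensTs)
            | (t1 \in tensT) && (t2 \in tensTs)] then Some [:: t1; t2]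
  else if [&& t1 \in tensTs, t2 \in tensT & tstar t1 == t2]
       then Some [:: vtensor (phi t2)]
  else None.

Definition is_T0 (u : seq (tensor G)) : bool :=
  if u is [:: t] then t \in tensT0 else false.

(* In the nonempty case the word is t_1 ... t_k with [belast t1 s] equal to
   t_1 ... t_(k-1) and [last t1 s] equal to t_k; [s != [::]] says k >= 2. *)
Definition wplus (w : seq (tensor G)) (t : tensor G) : tword :=
  if w is t1 :: s then
    if tplus (last t1 s) t is Some u then
      if (s != [::]) && is_T0 u then Some (belast t1 s)
      else Some (belast t1 s ++ u)
    else None
  else None.

Definition oplus (x y : tword) : tword :=
  if y is Some u then foldl (fun z t => obind (wplus^~ t) z) x u else None.

Inductive generated : tword -> Prop :=
  | generated_empty : generated None
  | generated_tensor t : t \in tens_gen -> generated (Some [:: t])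
  | generated_oplus x y : generated x -> generated y -> generated (oplus x y).

Definition tsg := {x : tword | `[< generated x >]}.
HB.instance Definition _ := Choice.on tsg.

Definition tsg_zero : tsg := exist _ None (asboolT generated_empty).

Lemma vtensor_gen v : vtensor v \in tens_gen.
Proof. by rewrite !inE codom_f. Qed.

Lemma etensor_gen e : etensor e \in tens_gen.
Proof. by rewrite !inE codom_f orbT. Qed.

Lemma itensor_gen e : itensor e \in tens_gen.
Proof. by rewrite !inE codom_f !orbT. Qed.

Definition tsg_tensor t (gt : t \in tens_gen) : tsg :=
  exist _ (Some [:: t]) (asboolT (generated_tensor gt)).

Definition tsg_op (x y : tsg) : tsg :=
  exist _ (oplus (val x) (val y))
    (asboolT (generated_oplus (asboolW (valP x)) (asboolW (valP y)))).

Variant gen_spec : tensor G -> Prop :=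
  | GenV v : gen_spec (vtensor v)
  | GenE e : gen_spec (etensor e)
  | GenI e : gen_spec (itensor e).

Lemma tens_genP t : t \in tens_gen -> gen_spec t.
Proof.
by rewrite !inE => /or3P[] /codomP[x ->]; constructor.
Qed.

Lemma T0V v : vtensor v \in tensT0. Proof. exact: codom_f. Qed.
Lemma TE e : etensor e \in tensT. Proof. exact: codom_f. Qed.
Lemma TsI e : itensor e \in tensTs. Proof. exact: codom_f. Qed.
Lemma T0E e : (etensor e \in tensT0) = false.
Proof. by apply/negP => /codomP[]. Qed.
Lemma T0I e : (itensor e \in tensT0) = false.
Proof. by apply/negP => /codomP[]. Qed.
Lemma TV v : (vtensor v \in tensT) = false.
Proof. by apply/negP => /codomP[]. Qed.
Lemma TI e : (itensor e \in tensT) = false.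
Proof. by apply/negP => /codomP[]. Qed.
Lemma TsV v : (vtensor v \in tensTs) = false.
Proof. by apply/negP => /codomP[]. Qed.
Lemma TsE e : (etensor e \in tensTs) = false.
Proof. by apply/negP => /codomP[]. Qed.

Definition memT := (T0V, T0E, T0I, TV, TE, TI, TsV, TsE, TsI).

Lemma tstarI e f : (tstar (itensor e) == etensor f) = (e == f).
Proof. by apply/eqP/eqP => [[]|->]. Qed.

Lemma tplusV t v : tplus t (vtensor v) =
  if phi t == v then Some [:: t] else None.
Proof.
rewrite /tplus !memT /=; case: eqP => //= _.
by rewrite !andbF.
Qed.

Lemma tplusVl v t : t \in tens_gen -> tplus (vtensor v) t =
  if v == psi t then Some [:: t] else None.
Proof.
case/tens_genP=> x; first by rewrite tplusV /=; case: eqP => // ->.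
  by rewrite /tplus !memT /=; case: eqP.
by rewrite /tplus !memT /=; case: eqP.
Qed.

Lemma tplusEE e f : tplus (etensor e) (etensor f) =
  if rng e == src f then Some [:: etensor e; etensor f] else None.
Proof. by rewrite /tplus !memT /=; case: eqP. Qed.

Lemma tplusEI e f : tplus (etensor e) (itensor f) =
  if rng e == rng f then Some [:: etensor e; itensor f] else None.
Proof. by rewrite /tplus !memT /=; case: eqP. Qed.

Lemma tplusII e f : tplus (itensor e) (itensor f) =
  if src e == rng f then Some [:: itensor e; itensor f] else None.
Proof. by rewrite /tplus !memT /=; case: eqP. Qed.

Lemma tplusIE e f : tplus (itensor e) (etensor f) =
  if e == f then Some [:: vtensor (rng f)] else None.
Proof. by rewrite /tplus !memT /= tstarI; case: (src e == src f). Qed.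

Lemma tplusVE v e : tplus (vtensor v) (etensor e) =
  if v == src e then Some [:: etensor e] else None.
Proof. by rewrite tplusVl ?etensor_gen. Qed.

Lemma tplusVI v e : tplus (vtensor v) (itensor e) =
  if v == rng e then Some [:: itensor e] else None.
Proof. by rewrite tplusVl ?itensor_gen. Qed.

Definition tplusE := (tplusV, tplusVE, tplusVI, tplusEE, tplusEI, tplusII, tplusIE).

Definition adjacent (t1 t2 : tensor G) : bool := tplus t1 t2 == Some [:: t1; t2].

Definition reduced (w : seq (tensor G)) : bool :=
  [&& w != [::], all [in tens_gen] w & sorted adjacent w].

Lemma reduced1 t : t \in tens_gen -> reduced [:: t].
Proof. by move=> gt; rewrite /reduced /= gt. Qed.

Lemma adjacentP t1 t2 : t1 \in tens_gen -> t2 \in tens_gen ->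
  adjacent t1 t2 ->
  [/\ phi t1 = psi t2, t1 \notin tensT0 & t2 \notin tensT0].
Proof.
rewrite /adjacent => /tens_genP[] x /tens_genP[] y; rewrite tplusE;
  by case: ifP => // /eqP E /eqP; rewrite ?memT.
Qed.

Lemma reduced_rcons2 s t1 t2 : reduced (rcons (rcons s t1) t2) =
  [&& reduced (rcons s t1), t2 \in tens_gen & adjacent t1 t2].
Proof.
rewrite /reduced !all_rcons; case: s => [|x s] /=.
  by rewrite !andbT /=; case: (t1 \in _); case: (t2 \in _).
rewrite -!cats1 !cat_path /= last_cat /= andbT.
by case: (t1 \in _); case: (t2 \in _); case: (x \in _); case: (all _ s);
  rewrite ?andbF ?andbT //= andbA.
Qed.

Lemma wplus_rcons s l t : wplus (rcons s l) t =
  if tplus l t is Some u then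
    if (s != [::]) && is_T0 u then Some s else Some (s ++ u)
  else None.
Proof.
case: s => [|x s] /=; first by case: tplus.
by rewrite last_rcons belast_rcons; case: s.
Qed.

(* [ends v x]: x is the empty-set symbol or a reduced word whose last
   contravariant index is v. *)
Definition ends (v : vertex G) (x : tword) : Prop :=
  if x is Some w then reduced w /\ exists s l, w = rcons s l /\ phi l = v
  else True.

Lemma ends_reduced v w : ends v (Some w) -> reduced w.
Proof. by case. Qed.

Variant tplus_spec (l t : tensor G) : tword -> Prop :=
  | TplusR of t = vtensor (phi l) : tplus_spec l t (Some [:: l])
  | TplusL of l = vtensor (psi t) & t \notin tensT0 :
      tplus_spec l t (Some [:: t])
  | TplusW of adjacent l t & l \notin tensT0 & t \notin tensT0 &
      phi l = psi t : tplus_spec l t (Some [:: l; t])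
  | TplusC e of l = itensor e & t = etensor e :
      tplus_spec l t (Some [:: vtensor (rng e)])
  | TplusI e f of e <> f & l = itensor e & t = etensor f : tplus_spec l t None
  | TplusN of phi l <> psi t : tplus_spec l t None.

Lemma tplusP l t : l \in tens_gen -> t \in tens_gen ->
  tplus_spec l t (tplus l t).
Proof.
move=> gl gt; move: (gl) (gt) => /tens_genP[] x /tens_genP[] y;
  rewrite tplusE; case: ifP => /eqP E;
  try (by apply: TplusN);
  try (by apply: TplusR; rewrite -E /=);
  try (by apply: TplusL; rewrite ?memT //= -E);
  try (by apply: TplusW; rewrite ?memT // /adjacent ?tplusE E eqxx).
- by rewrite -E; exact: TplusC.
- exact: TplusI E _ _.
Qed.

Lemma wplus_ends w t : reduced w -> t \in tens_gen -> ends (phi t) (wplus w t).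
Proof.
case/lastP: w => [//|s l] rw gt; rewrite wplus_rcons.
have gl : l \in tens_gen.
  by case/and3P: rw => _; rewrite all_rcons => /andP[].
case: (tplusP gl gt) => // [E|E tN|A lN tN _|e El Et] /=.
- rewrite (_ : _ && _ = false); last first.
    case/lastP: s rw => [//|s k]; rewrite reduced_rcons2 => /and3P[rk _ A].
    have gk : k \in tens_gen by case/and3P: rk => _; rewrite all_rcons => /andP[].
    by case: (adjacentP gk gl A) => _ _ /negbTE ->; rewrite andbF.
  by rewrite cats1; split=> //; exists s, l; rewrite E.
- rewrite (negbTE tN) andbF cats1.
  case/lastP: s rw => [_|s k].
    by split; [exact: reduced1 | exists [::], t].
  rewrite reduced_rcons2 => /and3P[rk _ A].
  have gk : k \in tens_gen by case/and3P: rk => _; rewrite all_rcons => /andP[].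
  by case: (adjacentP gk gl A) => _ _; rewrite E memT.
- rewrite andbF -cat_rcons cats1; split; last by exists (rcons s l), t.
  by rewrite reduced_rcons2 rw gt.
- rewrite memT andbT; case/lastP: s rw => [_|s k].
    split; first exact/reduced1/vtensor_gen.
    by exists [::], (vtensor (rng e)); rewrite Et.
  rewrite reduced_rcons2 => /and3P[rk _ A].
  have gk : k \in tens_gen by case/and3P: rk => _; rewrite all_rcons => /andP[].
  rewrite -size_eq0 size_rcons /=; split=> //; exists s, k; split=> //.
  by case: (adjacentP gk gl A) => ->; rewrite El Et.
Qed.

Definition oreduced (x : tword) : bool := if x is Some w then reduced w else true.

Definition act (x : tword) (t : tensor G) : tword := obind (wplus^~ t) x.

Lemma act_ends x t : oreduced x -> t \in tens_gen -> ends (phi t) (act x t).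
Proof. by case: x => [w|] //=; exact: wplus_ends. Qed.

Lemma ends_oreduced v x : ends v x -> oreduced x.
Proof. by case: x => [w|] //=; case. Qed.

Lemma act_oreduced x t : oreduced x -> t \in tens_gen -> oreduced (act x t).
Proof. by move=> rx gt; exact: ends_oreduced (act_ends rx gt). Qed.

Lemma act_vtensor v x : ends v x -> act x (vtensor v) = x.
Proof.
case: x => [w [rw [s [l [Ew El]]]]|] //=; rewrite Ew wplus_rcons tplusV El eqxx.
rewrite /= (_ : _ && _ = false) ?cats1 //.
move: rw; rewrite Ew; case/lastP: s {Ew} => [//|s k].
rewrite reduced_rcons2 => /and3P[rk gl A].
have gk : k \in tens_gen by case/and3P: rk => _; rewrite all_rcons => /andP[].
by case: (adjacentP gk gl A) => _ _ /negbTE ->; rewrite andbF.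
Qed.

Lemma act_None v x t : ends v x -> t \in tens_gen -> v <> psi t -> act x t = None.
Proof.
case: x => [w [rw [s [l [Ew El]]]]|] //= gt vt; rewrite Ew wplus_rcons.
have gl : l \in tens_gen.
  by move: rw; rewrite Ew => /and3P[_]; rewrite all_rcons => /andP[].
case: (tplusP gl gt) => // [E|E _|_ _ _ E|e E1 E2]; case: vt; rewrite -El //.
- by rewrite E.
- by rewrite E.
- by rewrite E1 E2.
Qed.

Lemma act_act x l t : oreduced x -> l \in tens_gen -> t \in tens_gen ->
  act (act x l) t = oplus x (tplus l t).
Proof.
move=> rx gl gt; have el := act_ends rx gl.
case: (tplusP gl gt) => [E|E tN|//|e El Et|e f ef El Et|N] /=.
- by rewrite [in LHS]E act_vtensor.
- case: x rx {el} => [w|] //= rw; case/lastP: w rw => [//|s k] rw.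
  have gk : k \in tens_gen by case/and3P: rw => _; rewrite all_rcons => /andP[].
  have ek : ends (phi k) (Some (rcons s k)) by split=> //; exists s, k.
  rewrite E; case: (phi k =P psi t) => [kt|kt].
    by rewrite -[wplus _ (vtensor _)]/(act (Some (rcons s k)) _) -kt act_vtensor.
  rewrite -[wplus _ (vtensor _)]/(act (Some (rcons s k)) _).
  rewrite (@act_None _ _ (vtensor _) ek) ?vtensor_gen //=.
  by rewrite -[wplus _ t]/(act (Some (rcons s k)) _) (act_None ek gt kt).
- case: x rx {el} => [w|] //= rw; case/lastP: w rw => [//|s k] rw.
  have gk : k \in tens_gen by case/and3P: rw => _; rewrite all_rcons => /andP[].
  have ek : ends (phi k) (Some (rcons s k)) by split=> //; exists s, k.
  rewrite -[wplus _ l]/(act (Some (rcons s k)) _).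
  rewrite -[wplus _ (vtensor _)]/(act (Some (rcons s k)) _).
  case: (phi k =P rng e) => [kt|kt]; last first.
    rewrite (act_None ek gl) ?El // (@act_None _ _ (vtensor _) ek) //.
    exact: vtensor_gen.
  rewrite -kt act_vtensor //= wplus_rcons El Et.
  have sk := tens_genP gk.
  move: rw gk kt {ek}; case: k / sk => y rw gk /= kt.
  + rewrite tplusE kt eqxx /is_T0 T0I andbF cats1 /act /= wplus_rcons.
    rewrite tplusIE eqxx /= memT andbT.
    case/lastP: s rw => [|s j]; first by rewrite /= kt.
    rewrite reduced_rcons2 => /and3P[rj _ A].
    have gj : j \in tens_gen by case/and3P: rj => _; rewrite all_rcons => /andP[].
    by case: (adjacentP gj gk A) => _ _; rewrite memT.
  + rewrite tplusEI kt eqxx /= andbF -cat_rcons cats1 /= wplus_rcons tplusIE eqxx.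
    by rewrite -size_eq0 size_rcons /= memT.
  + rewrite tplusII kt eqxx /= andbF -cat_rcons cats1 /= wplus_rcons tplusIE eqxx.
    by rewrite -size_eq0 size_rcons /= memT.
- case: x rx {el} => [w|] //= rw; case/lastP: w rw => [//|s k] rw.
  have gk : k \in tens_gen by case/and3P: rw => _; rewrite all_rcons => /andP[].
  rewrite wplus_rcons El Et.
  case: (tens_genP gk) => y; rewrite tplusE; case: ifP => // _;
    rewrite /is_T0 ?T0I andbF ?cats1 -?cat_rcons ?cats0 /act /= wplus_rcons;
    by rewrite tplusIE; case: eqP.
- exact: act_None el gt N.
Qed.

Lemma oplus_rcons x s t : oplus x (Some (rcons s t)) = act (oplus x (Some s)) t.
Proof. by rewrite /= foldl_rcons. Qed.

Lemma oplus_oreduced x u : oreduced x -> all [in tens_gen] u ->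
  oreduced (oplus x (Some u)).
Proof.
move=> rx; elim/last_ind: u => [//|u t IH]; rewrite all_rcons => /andP[gt gu].
by rewrite oplus_rcons act_oreduced ?IH.
Qed.

Lemma generated_oreduced x : generated x -> oreduced x.
Proof.
elim=> [//|t gt|y z _ ry _ rz]; first exact: reduced1.
by case: z rz => [u|] //= /and3P[_ gu _]; exact: oplus_oreduced.
Qed.

Lemma oplus_act x u t : oreduced x -> reduced u -> t \in tens_gen ->
  oplus x (act (Some u) t) = act (oplus x (Some u)) t.
Proof.
move=> rx; case/lastP: u => [//|s l] ru gt.
have /andP[gl gs] : (l \in tens_gen) && all [in tens_gen] s.
  by case/and3P: ru => _; rewrite all_rcons.
rewrite oplus_rcons act_act ?oplus_oreduced // /act /= wplus_rcons.
case: (tplusP gl gt) => //; try by move=> *; rewrite andbF /= foldl_cat.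
- move=> _; case: ifP => [/andP[s0 Tl]|_]; last by rewrite /= foldl_cat.
  case/lastP: s s0 gs ru => [//|s k] _ _; rewrite reduced_rcons2 => /and3P[rk _ A].
  have gk : k \in tens_gen by case/and3P: rk => _; rewrite all_rcons => /andP[].
  by case: (adjacentP gk gl A) => _ _ /negP[].
- move=> _ /negbTE tN; rewrite [is_T0 _]tN andbF.
  by rewrite /= foldl_cat.
- move=> e El _; case: ifP => [/andP[s0 _]|_]; last by rewrite /= foldl_cat.
  case/lastP: s s0 gs ru => [//|s k] _; rewrite all_rcons => /andP[gk gs].
  rewrite reduced_rcons2 => /and3P[rk _ A].
  have [pk _ _] := adjacentP gk gl A.
  rewrite /= -[RHS]/(act (oplus x (Some (rcons s k))) (vtensor (rng e))).
  rewrite act_vtensor // oplus_rcons.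
  have -> : rng e = phi k by rewrite pk El.
  by apply: act_ends; rewrite ?oplus_oreduced.
Qed.

Lemma oplus_None y : oplus None y = None.
Proof. by case: y => [u|] //=; elim: u. Qed.

Lemma oplusA x y z : oreduced x -> oreduced y -> oreduced z ->
  oplus x (oplus y z) = oplus (oplus x y) z.
Proof.
move=> rx; case: z => [u|] //; case: y => [w|]; last first.
  by rewrite [oplus x None]/= oplus_None.
move=> rw /and3P[_ gu _].
elim/last_ind: u gu => [//|u t IH]; rewrite all_rcons => /andP[gt gu].
rewrite !oplus_rcons -IH //.
have: oreduced (oplus (Some w) (Some u)) by exact: oplus_oreduced.
by case: (oplus (Some w) (Some u)) => [v|] // rv; rewrite oplus_act.
Qed.

Lemma tsg_opA : associative tsg_op.
Proof.
have red (x : tsg) : oreduced (val x).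
  by apply: generated_oreduced; exact: asboolW (valP x).
by move=> x y z; apply: val_inj; exact: oplusA.
Qed.

HB.instance Definition _ := isSemigroup.Build tsg tsg_opA.

End Tensors.

Record is_theta (G : digraph) (theta : gis G -> tsg G) : Prop := IsTheta {
  theta_vertex : forall v : vertex G,
    theta (gis_gen (Vtx v)) = tsg_tensor (vtensor_gen v);
  theta_edge : forall e : edge G,
    theta (gis_gen (Edg e)) = tsg_tensor (etensor_gen e);
  theta_inv : forall e : edge G,
    theta (gis_gen (Inv e)) = tsg_tensor (itensor_gen e);
  theta_zero : theta (gis_zero G) = tsg_zero G }.

(* Main.v *)
Require Import Defs.
From HB Require Import structures.
From mathcomp Require Import all_boot.
From mathcomp Require Import boolp.

(* Evaluating a term by reading generators as tensors and products as [oplus]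
   respects the defining relations, which gives theta; it is onto because the
   tensors and the empty set generate T(Gamma).  Conversely, multiplying out the
   symbols of a word in I(Gamma) turns [oplus] into the product on reduced words,
   since each case of [tplus] is an instance of a relation of I(Gamma).  This
   multiplicative map undoes theta on generators, so it is a left inverse. *)

Set Implicit Arguments.
Unset Strict Implicit.
Unset Printing Implicit Defensive.

Section Theta.
Variable G : digraph.

Implicit Types (a b : letter G) (t : tensor G) (s u w : seq (tensor G)).
Implicit Types (p q : term G) (x y : tword G).

Definition tensor_of a : tensor G :=
  match a with
  | Vtx v => vtensor v
  | Edg e => etensor e
  | Inv e => itensor e
  end.

Lemma tensor_of_gen a : tensor_of a \in tens_gen (G := G).
Proof. by case: a => z; [exact: vtensor_gen|exact: etensor_gen|exact: itensor_gen]. Qed.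

Lemma tensor_ofK a : tsym (tensor_of a) = a.
Proof. by case: a. Qed.

Lemma tsymK t : t \in tens_gen (G := G) -> tensor_of (tsym t) = t.
Proof. by case/tens_genP. Qed.

Lemma psi_tsym t : t \in tens_gen (G := G) -> psi t = lsrc (tsym t).
Proof. by case/tens_genP. Qed.

Lemma phi_tsym t : t \in tens_gen (G := G) -> phi t = lrng (tsym t).
Proof. by case/tens_genP. Qed.

Lemma oplus1 t1 t2 : oplus (Some [:: t1]) (Some [:: t2]) = tplus t1 t2.
Proof. by rewrite /=; case: tplus. Qed.

Fixpoint term_tsg p : tsg G :=
  match p with
  | TZero => tsg_zero G
  | TGen a => tsg_tensor (tensor_of_gen a)
  | TMul p q => tsg_op (term_tsg p) (term_tsg q)
  end.

Lemma term_tsg_cong p q : gis_cong p q -> term_tsg p = term_tsg q.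
Proof.
elim=> {p q} //=.
- by move=> p q r _ -> _ ->.
- by move=> p p' q q' _ -> _ ->.
- by move=> p q r; exact: tsg_opA.
- by move=> p; apply: val_inj; rewrite [LHS]oplus_None.
- by move=> p; apply: val_inj.
- move=> a; apply: val_inj.
  by rewrite [LHS]oplus1 tplusVl ?psi_tsym ?tensor_of_gen // tensor_ofK eqxx.
- move=> a; apply: val_inj.
  by rewrite [LHS]oplus1 tplusV phi_tsym ?tensor_of_gen // tensor_ofK eqxx.
- by move=> v v' /eqP/negbTE vv'; apply: val_inj; rewrite [LHS]oplus1 tplusV /= vv'.
- by move=> e f /eqP/negbTE ef; apply: val_inj; rewrite [LHS]oplus1 tplusIE ef.
- by move=> e; apply: val_inj; rewrite [LHS]oplus1 tplusIE eqxx.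
Qed.

(** The three ways of building an element of T(Gamma) match the three constructors of terms, so a
    term can be read off a derivation of [generated x]. *)
Lemma term_tsg_surj (z : tsg G) : exists p, term_tsg p = z.
Proof.
(* The claim is stated on underlying words, so that the induction on [generated] is not tied to the
   membership proof [gx]. *)
case: z => x gx; have [p px] : exists p, val (term_tsg p) = x.
  elim: (asboolW gx) => {x gx} [|t gt|x y _ [p <-] _ [q <-]].
  - by exists (TZero G).
  - by exists (TGen (tsym t)); rewrite /= tsymK.
  - by exists (TMul p q).
by exists p; apply: val_inj.
Qed.

Definition theta_fun (z : gis G) : tsg G := term_tsg (repr z).

Lemma theta_of p : theta_fun (gis_of p) = term_tsg p.
Proof. exact/term_tsg_cong/gis_repr. Qed.

Lemma theta_op : {morph theta_fun : z1 z2 / (z1 * z2)%g}.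
Proof.
move=> z1 z2; rewrite -(gis_ofK z1) -(gis_ofK z2) [(_ * _)%g]gis_opE.
by rewrite !theta_of.
Qed.

HB.instance Definition _ := isMultiplicative.Build (gis G) (tsg G) theta_fun theta_op.

Lemma is_theta_fun : is_theta theta_fun.
Proof. by split=> *; rewrite theta_of; apply: val_inj. Qed.

(** Every element of I(Gamma) is the class of a term, and multiplicativity reduces the term to
    generators and zero. *)
Lemma is_theta_uniq (f g : {multiplicative gis G -> tsg G}) :
  is_theta f -> is_theta g -> f =1 g.
Proof.
move=> [fv fe fi f0] [gv ge gi g0] z; rewrite -(gis_ofK z).
elim: (repr z) => [|[v|e|e]|p IHp q IHq]; rewrite -?[gis_of _]/(gis_gen _).
- by rewrite [LHS]f0 [RHS]g0.
- by rewrite fv gv.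
- by rewrite fe ge.
- by rewrite fi gi.
- by rewrite -gis_opE !gmulfM IHp IHq.
Qed.

(* The value on the empty list is irrelevant: words are nonempty. *)
Definition word_gis w : gis G :=
  if w is t :: s then foldl (fun z t => gis_op z (gis_gen (tsym t))) (gis_gen (tsym t)) s
  else gis_zero G.

Definition tword_gis x : gis G := if x is Some w then word_gis w else gis_zero G.

Lemma gis_op0 z : gis_op z (gis_zero G) = gis_zero G.
Proof. by rewrite -(gis_ofK z) gis_opE; apply/gis_ofP/gis_zeror. Qed.

Lemma gis_0op z : gis_op (gis_zero G) z = gis_zero G.
Proof. by rewrite -(gis_ofK z) gis_opE; apply/gis_ofP/gis_zerol. Qed.

Lemma gis_gen_src a : gis_op (gis_gen (Vtx (lsrc a))) (gis_gen a) = gis_gen a.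
Proof. by rewrite gis_opE; apply/gis_ofP/gis_I1l. Qed.

Lemma gis_gen_rng a : gis_op (gis_gen a) (gis_gen (Vtx (lrng a))) = gis_gen a.
Proof. by rewrite gis_opE; apply/gis_ofP/gis_I1r. Qed.

(** By (I1), a = a r(a) and b = s(b) b; the inner product r(a) s(b) of distinct vertices vanishes by
    (I2). *)
Lemma gis_gen_disconnected a b :
  lrng a <> lsrc b -> gis_op (gis_gen a) (gis_gen b) = gis_zero G.
Proof.
move=> ab; rewrite -(gis_gen_rng a) -(gis_gen_src b) -gis_opA.
rewrite (gis_opA (gis_gen (Vtx _))).
have -> : gis_op (gis_gen (Vtx (lrng a))) (gis_gen (Vtx (lsrc b))) = gis_zero G.
  by rewrite gis_opE; apply/gis_ofP/gis_I2.
by rewrite gis_0op gis_op0.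
Qed.

Lemma word_gis_rcons s t : s != [::] ->
  word_gis (rcons s t) = gis_op (word_gis s) (gis_gen (tsym t)).
Proof. by case: s => //= r s _; rewrite foldl_rcons. Qed.

(** Both words must be nonempty because [word_gis] sends the empty list to zero, not to an
    identity. *)
Lemma word_gis_cat s u : s != [::] -> u != [::] ->
  word_gis (s ++ u) = gis_op (word_gis s) (word_gis u).
Proof.
move=> s0; elim/last_ind: u => // u t IH _.
have [->|u0] := eqVneq u [::].
  by rewrite cats1 word_gis_rcons.
rewrite -rcons_cat !word_gis_rcons ?IH ?gis_opA //.
by case: (s) s0.
Qed.

Lemma tword_gis_tplus l t : l \in tens_gen (G := G) -> t \in tens_gen (G := G) ->
  tword_gis (tplus l t) = gis_op (gis_gen (tsym l)) (gis_gen (tsym t)).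
Proof.
move=> gl gt; case: (tplusP gl gt) => [->|-> _|//|e -> ->|e f ef -> ->|].
- by rewrite (phi_tsym gl) gis_gen_rng.
- by rewrite (psi_tsym gt) gis_gen_src.
- by rewrite gis_opE; apply/gis_ofP/gis_sym/gis_I4.
- by rewrite gis_opE; apply/gis_ofP/gis_sym/gis_I3.
- by rewrite (phi_tsym gl) (psi_tsym gt) => /gis_gen_disconnected ->.
Qed.

Lemma reduced_rcons_gen s t : reduced (rcons s t) -> t \in tens_gen (G := G).
Proof. by case/and3P=> _; rewrite all_rcons => /andP[]. Qed.

(** The range vertex of the last letter is a right identity for the word; this accounts for the
    vertex that [wplus] erases after a cancellation. *)
Lemma word_gis_phi s t : reduced (rcons s t) ->
  gis_op (word_gis (rcons s t)) (gis_gen (Vtx (phi t))) = word_gis (rcons s t).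
Proof.
move/reduced_rcons_gen => gt; rewrite (phi_tsym gt).
case: s => [|r s]; first exact: gis_gen_rng.
by rewrite word_gis_rcons // -gis_opA gis_gen_rng.
Qed.

(** Only the last letter of the word meets [t], so associativity reduces the claim to
    [tword_gis_tplus]. *)
Lemma tword_gis_act x t : oreduced x -> t \in tens_gen (G := G) ->
  tword_gis (act x t) = gis_op (tword_gis x) (gis_gen (tsym t)).
Proof.
case: x => [w|] /=; last by rewrite gis_0op.
case/lastP: w => // s l rw gt; have gl := reduced_rcons_gen rw.
rewrite wplus_rcons; have := tword_gis_tplus gl gt.
case/lastP: s rw => [|s k] rw; first by case: tplus.
have k0 : rcons s k != [::] by rewrite -size_eq0 size_rcons.
rewrite word_gis_rcons // -gis_opA => <-.
move: rw; rewrite reduced_rcons2 => /and3P[rk _ kl].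
(* In a reduced word of length at least 2 the last letter [l] is not a vertex, so a vertex can only
   come from a cancellation. *)
have [phi_k _ lN] := adjacentP (reduced_rcons_gen rk) gl kl.
case: (tplusP gl gt) => [_|El _|*|e El _|*|*] /=; rewrite ?gis_op0 ?k0 //.
- by rewrite (negbTE lN) /= word_gis_cat.
- by move: lN; rewrite El T0V.
- by rewrite /= word_gis_cat.
(* The product of e* and e leaves the vertex r(e), which is the source of [l] and hence the range of
   the preceding letter [k]. *)
- by rewrite T0V -[rng e]/(psi (itensor e)) -El -phi_k word_gis_phi.
Qed.

Lemma tword_gis_oplus x y : oreduced x -> oreduced y ->
  tword_gis (oplus x y) = gis_op (tword_gis x) (tword_gis y).
Proof.
case: y => [u|] rx; last by rewrite gis_op0.
case/and3P=> u0 gu _; elim/last_ind: u u0 gu => // u t IH _.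
rewrite all_rcons => /andP[gt gu].
rewrite oplus_rcons tword_gis_act ?oplus_oreduced //.
(* The induction really starts at one-letter words, where [tword_gis_act] is already the claim. *)
have [-> //|u0] := eqVneq u [::].
by rewrite IH //= word_gis_rcons // gis_opA.
Qed.

Lemma theta_funK : cancel theta_fun (fun z => tword_gis (val z)).
Proof.
move=> z; rewrite /theta_fun -[RHS]gis_ofK.
have red (z' : tsg G) : oreduced (val z').
  exact: generated_oreduced (asboolW (valP z')).
elim: (repr z) => [//|a|p IHp q IHq].
  by rewrite [LHS]/(gis_gen _) tensor_ofK.
by rewrite -gis_opE -IHp -IHq -tword_gis_oplus.
Qed.

Lemma theta_fun_bij : bijective theta_fun.
Proof.
exists (fun z => tword_gis (val z)); first exact: theta_funK.
(* Surjectivity makes the left inverse two-sided. *)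
move=> z; have [p <-] := term_tsg_surj z.
by rewrite -theta_of theta_funK.
Qed.

End Theta.

(* [theta] is the unique multiplicative map with the prescribed values on the
   generators, and it is bijective. *)
Theorem proposition5p4 (G : digraph) :
  exists theta : {multiplicative gis G -> tsg G},
    [/\ is_theta theta,
        (forall theta' : {multiplicative gis G -> tsg G},
            is_theta theta' -> theta' =1 theta)
      & bijective theta].
Proof.
exists (@theta_fun G); split; first exact: is_theta_fun.
- by move=> theta' th'; exact: is_theta_uniq th' (@is_theta_fun G).
- exact: theta_fun_bij.
Qed.
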